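(* Let $\Delta t,\Delta x>0$, and for $\varepsilon>0$ put $\mu=\Delta t/\varepsilon$. Let $\mathcal{L}^1,\mathcal{L}^2$ be the operators defined in the context. Assume: (i) the numerical flux is linear: $\widehat{\mathcal{F}}_{k+1/2}=\sum_{l=-r}^{s}\alpha_l\,\mathcal{F}_{k+l}$ with fixed real coefficients $\alpha_l$; (ii) the Maxwellian $\mathbb{M}$ is Lipschitz continuous; (iii) there exist $C,C'>0$ such that for all $\varepsilon>0$ the matrix $\mathrm{Id}_{q\times q}+\mu A$ is invertible with $$\big\Vert (\mathrm{Id}_{q\times q}+\mu A)^{-1}\big\Vert\le C,\qquad \mu\,\big\Vert(\mathrm{Id}_{q\times q}+\mu A)^{-1}A\big\Vert\le C'.$$ Then there exists $\theta>0$ independent of $\varepsilon$ such that the following holds. If $\mathcal{F}^\star$ is the unique solution of $\mathcal{L}^2(\mathcal{F})=0$, and $(\mathcal{F}^{(p)})_{p\ge0}$ are the deferred correction iterates defined by $\mathcal{F}^{(0)}_k=(\mathbf{F}^n_k,\dots,\mathbf{F}^n_k)$ and $$\mathcal{L}^1(\mathcal{F}^{(p+1)})=\mathcal{L}^1(\mathcal{F}^{(p)})-\mathcal{L}^2(\mathcal{F}^{(p)}),\qquad p\ge0,$$ then for all $p\in\mathbb{N}$ $$\Vert\mathcal{F}^{(p+1)}-\mathcal{F}^\star\Vert_{L^2}\le(\theta\,\Delta t)^{p+1}\,\Vert\mathcal{F}^{(0)}-\mathcal{F}^\star\Vert_{L^2}.$$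
   Context: Kinetic setting. Let $m,N\ge1$. The relaxation system is $\partial_t\mathbf{F}+\Lambda\,\partial_x\mathbf{F}=\varepsilon^{-1}(\mathbb{M}(\mathbb{P}\mathbf{F})-\mathbf{F})$ with unknown $\mathbf{F}(x,t)\in V:=\mathbb{R}^{N\times m}$. Here $\Lambda$ is a constant real diagonal matrix acting on $V$, $\mathbb{P}:V\to\mathbb{R}^m$ is linear, and the Maxwellian $\mathbb{M}:\mathbb{R}^m\to V$ satisfies $\mathbb{P}\mathbb{M}(\mathbf{u})=\mathbf{u}$ for all $\mathbf{u}$ (and $\mathbb{P}\Lambda\mathbb{M}(\mathbf{u})=\mathbf{f}(\mathbf{u})$, where $\mathbf{f}$ is the flux of the limiting conservation law $\partial_t\mathbf{u}+\partial_x\mathbf{f}(\mathbf{u})=0$). Time quadrature. Let $q\ge1$, $0=c_0<c_1<\dots<c_q=1$, let $\ell_0,\dots,\ell_q$ be the Lagrange polynomials of these nodes, and set $a_{ij}=\int_0^{c_i}\ell_j(s)\,ds$, so $\sum_{j=0}^q a_{ij}=c_i$. Let $A=(a_{ij})_{1\le i,j\le q}$, $\mathbf{a}_0=(a_{10},\dots,a_{q0})^T$, $C_{\mathrm{diag}}=\mathrm{diag}(c_1,\dots,c_q)$. Space. Grid points are $x_k=k\Delta x$, $k\in\mathbb{Z}$. The difference operator is $\delta_k\mathbf{F}=\widehat{\mathbf{F}}_{k+1/2}-\widehat{\mathbf{F}}_{k-1/2}$, with $\delta_k\mathbf{F}/\Delta x$ a consistent approximation of $\partial_x\mathbf{F}$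 at $x_k$. Notation. The time-level data $(\mathbf{F}^n_k)_{k\in\mathbb{Z}}$, $\mathbf{F}^n_k\in V$, is given. Write $\mathcal{F}=(\mathcal{F}_k)_{k\in\mathbb{Z}}$ with $\mathcal{F}_k=(\mathbf{F}^1_k,\dots,\mathbf{F}^q_k)\in V^q$. Put $\mathcal{F}^{(0)}_k=(\mathbf{F}^n_k,\dots,\mathbf{F}^n_k)\in V^q$. The $q\times q$ matrices act on $V^q$ by mixing the $q$ sub-time-step entries; $\mathbb{P}$, $\mathbb{M}$, $\Lambda$, $\delta_k$ act on each of the $q$ entries separately; $\mathbf{a}_0\otimes w=(a_{10}w,\dots,a_{q0}w)$ for $w\in V$. Operators. $$[\mathcal{L}^1(\mathcal{F})]_k=\mathcal{F}_k-\mathcal{F}^{(0)}_k+\tfrac{\Delta t}{\Delta x}C_{\mathrm{diag}}\Lambda\,\delta_k\mathcal{F}^{(0)}-\mu A\big(\mathbb{M}(\mathbb{P}\mathcal{F}_k)-\mathcal{F}_k\big)-\mu\,\mathbf{a}_0\otimes\big(\mathbb{M}(\mathbb{P}\mathbf{F}^n_k)-\mathbf{F}^n_k\big),$$ $$[\mathcal{L}^2(\mathcal{F})]_k=\mathcal{F}_k-\mathcal{F}^{(0)}_k+\tfrac{\Delta t}{\Delta x}\Lambda A\,\delta_k\mathcal{F}-\mu A\big(\mathbb{M}(\mathbb{P}\mathcal{F}_k)-\mathcal{F}_k\big)+\tfrac{\Delta t}{\Delta x}\,\mathbf{a}_0\otimes\Lambda\,\delta_k\mathbf{F}^n-\mu\,\mathbf{a}_0\otimes\big(\mathbb{M}(\mathbb{P}\mathbf{F}^n_k)-\mathbf{F}^n_k\big).$$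 Norm. $\Vert\mathcal{F}\Vert_{L^2}^2=\sum_{k\in\mathbb{Z}}\Delta x\,\Vert\mathcal{F}_k\Vert^2$ (Euclidean norm on $V^q$), possibly $+\infty$. *)

(* Defs.v *)
From HB Require Import structures.
From mathcomp Require Export all_boot all_order all_algebra.
From mathcomp Require Export all_classical all_reals all_analysis.
Export numFieldNormedType.Exports.

Set Implicit Arguments.
Unset Strict Implicit.
Unset Printing Implicit Defensive.

Import Order.TTheory GRing.Theory Num.Theory.

Local Open Scope classical_set_scope.
Local Open Scope ring_scope.

Section Norms.
Context {R : realType}.

(* The norm that the library puts on matrices is the max norm. *)
Definition enorm (a b : nat) (B : 'M[R]_(a, b)) : R :=
  Num.sqrt (\sum_i \sum_j B i j ^+ 2).

(* Matrix norm subordinate to the Euclidean norm on R^b. *)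
Definition opnorm (a b : nat) (B : 'M[R]_(a, b)) : R :=
  sup [set enorm (B *m x) | x in [set x : 'cV[R]_b | enorm x <= 1]].

Definition enorm_tuple (N m q : nat) (U : {ffun 'I_q -> 'M[R]_(N, m)}) : R :=
  Num.sqrt (\sum_i enorm (U i) ^+ 2).

Definition l2norm (N m q : nat) (dx : R)
    (F : int -> {ffun 'I_q -> 'M[R]_(N, m)}) : \bar R :=
  sqrte (\esum_(k in [set: int]) (dx * enorm_tuple (F k) ^+ 2)%:E)%E.

End Norms.

Section Quadrature.
Context {R : realType} {q : nat} (c : 'I_q.+1 -> R).

(* The library's [lagrange] takes an infinite injective family of nodes. *)
Definition lagrange_poly (j : 'I_q.+1) : {poly R} :=
  \prod_(k < q.+1 | k != j) ((c j - c k)^-1 *: ('X - (c k)%:P)).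

Definition quad_coef (i j : 'I_q.+1) : R :=
  \int[lebesgue_measure]_(x in `[0, c i]) (lagrange_poly j).[x].

(* [lift ord0] sends 0, ..., q-1 to 1, ..., q. *)
Definition quad_mx : 'M[R]_q :=
  \matrix_(i, j) quad_coef (lift ord0 i) (lift ord0 j).

Definition quad_col0 : 'cV[R]_q := \col_i quad_coef (lift ord0 i) ord0.

Definition node_mx : 'M[R]_q := diag_mx (\row_i c (lift ord0 i)).

End Quadrature.

Section Flux.
Context {R : realType} (r s : nat) (alpha : int -> R).

(* Numerical flux at k + 1/2: the sum over l = i - r from -r to s. *)
Definition num_flux (W : lmodType R) (F : int -> W) (k : int) : W :=
  \sum_(i < (r + s).+1)
    alpha (i%:Z - r%:Z) *: F (k + (i%:Z - r%:Z)).

Definition delta (W : lmodType R) (F : int -> W) (k : int) : W :=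
  num_flux F k - num_flux F (k - 1).

Definition consistent : Prop :=
  forall phi : R -> R,
    (forall (n : nat) (x : R), derivable (derive1n n phi) x 1) ->
    forall x : R,
      (fun h : R => delta (fun k => phi (x + k%:~R * h) : R^o) 0 / h) h
        @[h --> 0^'+] --> derive1 phi x.

End Flux.

Section Operators.
Context {R : realType} {N m q : nat}.
Local Notation V := 'M[R]_(N, m).
Local Notation Vq := {ffun 'I_q -> 'M[R]_(N, m)}.

Definition mix (B : 'M[R]_q) (U : Vq) : Vq := [ffun i => \sum_j B i j *: U j].

Definition entrywise (g : V -> V) (U : Vq) : Vq := [ffun i => g (U i)].

Definition tens (a : 'cV[R]_q) (w : V) : Vq := [ffun i => a i 0 *: w].

(* Action of a matrix on V = R^(N x m), identified with R^(N * m).  It is only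
   used for diagonal matrices, for which the side of the product is immaterial. *)
Definition mxact (L : 'M[R]_(N * m)) (v : V) : V := vec_mx (mxvec v *m L).

Definition start (Fn : int -> V) (k : int) : Vq := [ffun=> Fn k].

Context (c : 'I_q.+1 -> R) (Lambda : 'M[R]_(N * m)).
Context (P : V -> 'rV[R]_m) (M : 'rV[R]_m -> V).
Context (r s : nat) (alpha : int -> R) (dt dx mu : R) (Fn : int -> V).

Let A : 'M[R]_q := quad_mx c.
Let a0 : 'cV[R]_q := quad_col0 c.
Let MP (v : V) : V := M (P v).

(* [delta] uses the pointwise module structure of V^q, hence acts on each of
   the q entries separately. *)
Definition opL1 (F : int -> Vq) (k : int) : Vq :=
  F k - start Fn k
  + (dt / dx) *: mix (node_mx c)
                   (entrywise (mxact Lambda) (delta r s alpha (start Fn) k))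
  - mu *: mix A (entrywise MP (F k) - F k)
  - mu *: tens a0 (MP (Fn k) - Fn k).

Definition opL2 (F : int -> Vq) (k : int) : Vq :=
  F k - start Fn k
  + (dt / dx) *: entrywise (mxact Lambda) (mix A (delta r s alpha F k))
  - mu *: mix A (entrywise MP (F k) - F k)
  + (dt / dx) *: tens a0 (mxact Lambda (delta r s alpha Fn k))
  - mu *: tens a0 (MP (Fn k) - Fn k).

End Operators.

(* Main.v *)
(* Write [E], [E'] for the errors of two successive iterates [F], [F'].
   Subtracting [L2 Fs = 0] from the correction step cancels the data and leaves
     (1 + mu A) E' = mu A (M P F' - M P Fs) - dt/dx Lambda A delta E.
   Applying [P], which satisfies [P M P = P], removes all terms carrying [mu]:
     P E' = - dt/dx P Lambda A delta E,
   so the macroscopic error is O(dt) uniformly in [eps].  Multiplying the first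
   identity by [(1 + mu A)^-1] and using the uniform bounds on [(1 + mu A)^-1]
   and [mu (1 + mu A)^-1 A] together with the Lipschitz bound on [M] then
   controls [E'] at each grid point by the values of [E] on the stencil of
   [delta]; shift invariance of the sum over the grid turns this into the l^2
   estimate. *)
From HB Require Import structures.
Require Import Defs.
From mathcomp Require Import ring lra.

Set Implicit Arguments.
Unset Strict Implicit.
Unset Printing Implicit Defensive.

Import Order.TTheory GRing.Theory Num.Theory.

Local Open Scope classical_set_scope.
Local Open Scope ring_scope.

(** * Comparison of Euclidean, operator and max norms; boundedness of linear and Lipschitz maps *)

Section Norms.
Context {R : realType}.

Lemma sum2_le_const (I J : finType) (F : I -> J -> R) (C : R) :
  (forall i j, F i j <= C) -> \sum_i \sum_j F i j <= #|I|%:R * #|J|%:R * C.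
Proof.
move=> FC; apply: (@le_trans _ _ (\sum_(i : I) \sum_(j : J) C)).
  by apply: ler_sum => i _; apply: ler_sum => j _.
by rewrite !sumr_const -[leLHS]mulr_natl -[C *+ _]mulr_natl mulrA.
Qed.

Lemma enorm_ge0 (a b : nat) (B : 'M[R]_(a, b)) : 0 <= enorm B.
Proof. exact: sqrtr_ge0. Qed.

Lemma sqr_enorm (a b : nat) (B : 'M[R]_(a, b)) :
  enorm B ^+ 2 = \sum_i \sum_j B i j ^+ 2.
Proof.
by rewrite sqr_sqrtr//; do 2 (apply: sumr_ge0 => ? _); exact: sqr_ge0.
Qed.

Lemma le_entry_enorm (a b : nat) (B : 'M[R]_(a, b)) i j : `|B i j| <= enorm B.
Proof.
rewrite -ler_sqr ?nnegrE ?enorm_ge0// real_normK ?num_real// sqr_enorm.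
rewrite (bigD1 i)//= (bigD1 j)//= -addrA lerDl addr_ge0//.
  by apply: sumr_ge0 => ? _; exact: sqr_ge0.
by do 2 (apply: sumr_ge0 => ? _); exact: sqr_ge0.
Qed.

(** The entry is a coordinate of the image of a basis vector, which lies in the unit ball. This
    turns the operator norm bounds into entrywise ones. *)
Lemma le_entry_opnorm (a b : nat) (B : 'M[R]_(a, b)) i j :
  `|B i j| <= opnorm B.
Proof.
pose e : 'cV[R]_b := delta_mx j 0.
have Bij : (B *m e) i 0 = B i j by rewrite -colE mxE.
rewrite -Bij; apply: le_trans (le_entry_enorm _ _ _) _.
apply: ub_le_sup; last first.
  exists e => //=; rewrite -[leRHS]sqrtr1 ler_sqrt//.
  rewrite (bigD1 j)//= big_ord1 mxE !eqxx expr1n big1 ?addr0// => k /negbTE kj.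
  by rewrite big_ord1 mxE kj expr0n.
(* [ub_le_sup] requires a bounded set: on the unit ball every coordinate of the image is at most [K]
   in absolute value. *)
pose K := \sum_i \sum_j `|B i j|.
exists (Num.sqrt (#|'I_a|%:R * #|'I_1|%:R * K ^+ 2)) => _ /= [x x1 <-].
rewrite ler_wsqrtr//; apply: sum2_le_const => k l.
rewrite -[leLHS]real_normK ?num_real// ler_sqr ?nnegrE//; last first.
  by do 2 (apply: sumr_ge0 => ? _).
rewrite mxE; apply: le_trans (ler_norm_sum _ _ _) _.
apply: (@le_trans _ _ (\sum_j0 `|B k j0|)).
  apply: ler_sum => p _; rewrite normrM ler_piMr//.
  exact: le_trans (le_entry_enorm _ _ _) x1.
by rewrite /K [leRHS](bigD1 k)//= lerDl; do 2 (apply: sumr_ge0 => ? _).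
Qed.

Lemma mx_norm_le (a b : nat) (v : 'M[R]_(a, b)) (C : R) : 0 <= C ->
  (forall i j, `|v i j| <= C) -> `|v| <= C.
Proof.
move=> C0 vC; rewrite [leLHS]/Num.norm /= mx_normrE; apply/bigmax_leP.
by split=> // -[i j] _; exact: vC.
Qed.

Lemma le_entry_norm (a b : nat) (v : 'M[R]_(a, b)) i j : `|v i j| <= `|v|.
Proof.
rewrite [leRHS]/Num.norm /= mx_normrE.
exact: (le_bigmax _ (fun ij : 'I_a * 'I_b => `|v ij.1 ij.2|) (i, j)).
Qed.

(** Expand [v] in elementary matrices; the constant is the sum of the norms of their images. *)
Lemma linear_mx_bounded (a b : nat) (W : normedModType R)
    (g : {linear 'M[R]_(a, b) -> W}) :
  exists2 K : R, 0 <= K & forall v, `|g v| <= K * `|v|.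
Proof.
exists (\sum_i \sum_j `|g (delta_mx i j)|) => [|v].
  by do 2 (apply: sumr_ge0 => ? _).
rewrite {1}(matrix_sum_delta v) linear_sum mulr_suml.
apply: le_trans (ler_norm_sum _ _ _) _; apply: ler_sum => i _.
rewrite linear_sum mulr_suml.
apply: le_trans (ler_norm_sum _ _ _) _; apply: ler_sum => j _.
by rewrite linearZ normrZ mulrC ler_wpM2l// le_entry_norm.
Qed.

(** The Lipschitz bound holds for all constants near +oo, so a nonnegative one can be picked. *)
Lemma lipschitz_bound (V W : normedModType R) (g : V -> W) : lipschitz g ->
  exists2 K : R, 0 <= K & forall x y, `|g x - g y| <= K * `|x - y|.
Proof.
move=> gL.
have [K [K0 gK]] := filter_ex (filterI (nbhs_pinfty_ge (num_real (0 : R))) gL).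
by exists K => // x y; exact: (gK (x, y)).
Qed.

End Norms.

(** * Cauchy-Schwarz, scaling and shifts of sums over the grid *)

Section Sums.
Context {R : realType}.

(** Expand the square and bound each product [a i * a j] by half the sum of the two squares. *)
Lemma sqr_sum_le (I : Type) (js : seq I) (a : I -> R) :
  (\sum_(j <- js) a j) ^+ 2 <= (size js)%:R * \sum_(j <- js) a j ^+ 2.
Proof.
rewrite expr2 big_distrlr /=.
have E : (size js)%:R * \sum_(j <- js) a j ^+ 2 =
    \sum_(i <- js) \sum_(j <- js) (a i ^+ 2 + a j ^+ 2) / 2.
  transitivity (\sum_(i <- js)
      ((size js)%:R * a i ^+ 2 + \sum_(j <- js) a j ^+ 2) / 2); last first.
    apply: eq_bigr => i _; rewrite -mulr_suml big_split/=.
    by rewrite big_const_seq count_predT iter_addr_0 mulr_natl.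
  rewrite -mulr_suml big_split/= -mulr_sumr big_const_seq count_predT.
  by rewrite iter_addr_0 -[_ *+ size js]mulr_natl; lra.
rewrite E; apply: ler_sum => i _; apply: ler_sum => j _.
by have := sqr_ge0 (a i - a j); rewrite -subr_ge0 sqrrB; lra.
Qed.

Lemma esumZl (T : choiceType) (K : R) (a : T -> \bar R) : 0 <= K ->
  (forall i, 0 <= a i)%E ->
  (\esum_(i in setT) (K%:E * a i) <= K%:E * \esum_(i in setT) a i)%E.
Proof.
move=> K0 a0; apply: ge_ereal_sup => _ [X XI <-].
rewrite -ge0_mule_fsumr//; apply: lee_wpmul2l; first by rewrite lee_fin.
by apply: ereal_sup_ubound; exists X.
Qed.

Lemma esum_shift (j : int) (a : int -> \bar R) :
  (\esum_(k in setT) a (k + j)%R = \esum_(k in setT) a k)%E.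
Proof.
rewrite [RHS](@reindex_esum _ _ _ setT setT (fun k => k + j))//.
split=> //; first by move=> x y _ _ /addIr.
by move=> k _; exists (k - j) => //; rewrite subrK.
Qed.

End Sums.

(** * Norms and mixing matrices on V^q, and the l^2 stencil estimate *)

Section TupleNorm.
Context {R : realType} {N m q : nat}.
Local Notation V := 'M[R]_(N, m).
Local Notation Vq := {ffun 'I_q -> V}.
Implicit Types U W : Vq.

(** Working norm for the pointwise estimates, equivalent to [enorm_tuple] with constants depending
    only on N, m and q. *)
Definition sum_norm U : R := \sum_i `|U i|.

Lemma sum_norm_ge0 U : 0 <= sum_norm U.
Proof. exact: sumr_ge0. Qed.

Lemma sum_normD U W : sum_norm (U + W) <= sum_norm U + sum_norm W.
Proof.
rewrite /sum_norm -big_split/=; apply: ler_sum => i _.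
by rewrite ffunE ler_normD.
Qed.

Lemma sum_normZ (a : R) U : sum_norm (a *: U) = `|a| * sum_norm U.
Proof. by rewrite mulr_sumr; apply: eq_bigr => i _; rewrite ffunE normrZ. Qed.

Lemma sum_normN U : sum_norm (- U) = sum_norm U.
Proof. by apply: eq_bigr => i _; rewrite ffunE normrN. Qed.

Lemma sum_norm_sum (I : Type) (r : seq I) (F : I -> Vq) :
  sum_norm (\sum_(i <- r) F i) <= \sum_(i <- r) sum_norm (F i).
Proof.
elim/big_rec2 : _ => [|i x U _ Ux].
  by rewrite /sum_norm big1// => i _; rewrite ffunE normr0.
by apply: le_trans (sum_normD _ _) _; rewrite lerD2l.
Qed.

Lemma sum_norm_entrywise (g : V -> V) (K : R) U :
  (forall v, `|g v| <= K * `|v|) -> sum_norm (entrywise g U) <= K * sum_norm U.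
Proof.
by move=> gK; rewrite mulr_sumr; apply: ler_sum => i _; rewrite ffunE.
Qed.

Lemma sum_norm_mix (B : 'M[R]_q) (b : R) U :
  (forall i j, `|B i j| <= b) -> sum_norm (mix B U) <= q%:R * b * sum_norm U.
Proof.
move=> Bb; have bU : sum_norm (mix B U) <= \sum_(i < q) (b * sum_norm U).
  apply: ler_sum => i _; rewrite ffunE mulr_sumr.
  apply: le_trans (ler_norm_sum _ _ _) _; apply: ler_sum => j _.
  by rewrite normrZ ler_wpM2r.
by apply: le_trans bU _; rewrite sumr_const card_ord -mulrA mulr_natl.
Qed.

Lemma mixB (B : 'M[R]_q) U W : mix B (U - W) = mix B U - mix B W.
Proof.
apply/ffunP => i; rewrite !ffunE -sumrB; apply: eq_bigr => j _.
by rewrite !ffunE scalerBr.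
Qed.

Lemma mixZ (B : 'M[R]_q) (a : R) U : mix B (a *: U) = a *: mix B U.
Proof.
apply/ffunP => i; rewrite !ffunE scaler_sumr; apply: eq_bigr => j _.
by rewrite ffunE !scalerA mulrC.
Qed.

Lemma mix_mul (B C : 'M[R]_q) U : mix (B *m C) U = mix B (mix C U).
Proof.
apply/ffunP => i; rewrite !ffunE.
under [RHS]eq_bigr do rewrite ffunE scaler_sumr.
rewrite exchange_big/=; apply: eq_bigr => j _.
by rewrite mxE scaler_suml; apply: eq_bigr => k _; rewrite scalerA.
Qed.

Lemma mix_scale (B : 'M[R]_q) (a : R) U : mix (a *: B) U = a *: mix B U.
Proof.
apply/ffunP => i; rewrite !ffunE scaler_sumr; apply: eq_bigr => j _.
by rewrite mxE scalerA.
Qed.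

Lemma mixDl (B C : 'M[R]_q) U : mix (B + C) U = mix B U + mix C U.
Proof.
apply/ffunP => i; rewrite !ffunE -big_split/=; apply: eq_bigr => j _.
by rewrite mxE scalerDl.
Qed.

Lemma mix1 U : mix 1%:M U = U.
Proof.
apply/ffunP => i; rewrite ffunE (bigD1 i)//= big1 => [|j /negbTE ji].
  by rewrite mxE eqxx scale1r addr0.
by rewrite mxE eq_sym ji scale0r.
Qed.

Lemma enorm_tuple_ge0 U : 0 <= enorm_tuple U.
Proof. exact: sqrtr_ge0. Qed.

Lemma sqr_enorm_tuple U : enorm_tuple U ^+ 2 = \sum_i enorm (U i) ^+ 2.
Proof. by rewrite sqr_sqrtr//; apply: sumr_ge0 => ? _; exact: sqr_ge0. Qed.

Lemma sum_norm_le_enorm U : sum_norm U <= q%:R * enorm_tuple U.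
Proof.
rewrite mulr_natl -[X in _ *+ X]card_ord -sumr_const; apply: ler_sum => i _.
apply: (@le_trans _ _ (enorm (U i))).
  by apply: mx_norm_le => [|a b]; [exact: enorm_ge0|exact: le_entry_enorm].
rewrite -ler_sqr ?nnegrE ?enorm_ge0 ?enorm_tuple_ge0// sqr_enorm_tuple.
by rewrite (bigD1 i)//= lerDl; apply: sumr_ge0 => ? _; exact: sqr_ge0.
Qed.

Lemma enorm_le_norm (v : V) : enorm v <= N%:R * m%:R * `|v|.
Proof.
rewrite -ler_sqr ?nnegrE ?enorm_ge0 ?mulr_ge0// sqr_enorm.
apply: (@le_trans _ _ (N%:R * m%:R * `|v| ^+ 2)).
  rewrite -[X in X%:R * _ * _]card_ord -[X in _ * X%:R * _]card_ord.
  apply: sum2_le_const => i j; rewrite -[leLHS]real_normK ?num_real//.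
  by rewrite ler_sqr ?nnegrE// le_entry_norm.
(* It remains to see that the natural number N m is at most its square. *)
rewrite exprMn ler_wpM2r ?sqr_ge0// -natrM -natrX ler_nat.
by case: (N * m)%N => // n; rewrite expnS leq_pmulr// expn_gt0.
Qed.

Lemma enorm_tuple_le U : enorm_tuple U <= N%:R * m%:R * sum_norm U.
Proof.
rewrite -ler_sqr ?nnegrE ?enorm_tuple_ge0 ?mulr_ge0 ?sum_norm_ge0//.
rewrite sqr_enorm_tuple.
apply: (@le_trans _ _ ((\sum_i enorm (U i)) ^+ 2)).
  rewrite expr2 mulr_suml; apply: ler_sum => i _.
  rewrite expr2 ler_wpM2l ?enorm_ge0// (bigD1 i)//= lerDl.
  by apply: sumr_ge0 => ? _; exact: enorm_ge0.
rewrite ler_sqr ?nnegrE ?mulr_ge0 ?sum_norm_ge0//; last first.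
  by apply: sumr_ge0 => ? _; exact: enorm_ge0.
by rewrite /sum_norm mulr_sumr; apply: ler_sum => i _; exact: enorm_le_norm.
Qed.

(* The l^2 norm is invariant under shifts of the grid. *)
Lemma l2norm_le_stencil (dx K : R) (js : seq int) (G H : int -> Vq) :
  0 <= dx -> 0 <= K ->
  (forall k, enorm_tuple (G k) <=
             K * \sum_(j <- js) enorm_tuple (H (k + j))) ->
  (l2norm dx G <= (K * (size js)%:R)%:E * l2norm dx H)%E.
Proof.
move=> dx0 K0 GH; set n : R := (size js)%:R.
have Kn0 : 0 <= K * n by rewrite mulr_ge0.
have h0 k : (0 <= (dx * enorm_tuple (H k) ^+ 2)%:E)%E.
  by rewrite lee_fin mulr_ge0 ?sqr_ge0.
have -> : (K * n)%:E = sqrte ((K * n)%:E ^+ 2) :> \bar R.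
  by rewrite sqrte_sqr gee0_abs ?lee_fin.
have Kn2 : (0 <= (K * n)%:E ^+ 2)%E by rewrite -EFin_expe lee_fin sqr_ge0.
rewrite /l2norm -sqrteM// lee_sqrt ?mule_ge0 ?esum_ge0// -EFin_expe.
(* Cauchy-Schwarz over the stencil costs one factor [n]; summing the [n] shifted copies costs
   another, hence [n] itself outside the square root. *)
apply: (@le_trans _ _ (\esum_(k in setT) ((K ^+ 2 * n)%:E *
    \sum_(j <- js) (dx * enorm_tuple (H (k + j)%R) ^+ 2)%:E))%E).
  apply: le_esum => k _; rewrite sumEFin -EFinM lee_fin -mulr_sumr.
  rewrite [leRHS]mulrCA ler_wpM2l// -mulrA.
  apply: (@le_trans _ _ ((K * \sum_(j <- js) enorm_tuple (H (k + j))) ^+ 2)).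
    rewrite ler_sqr ?nnegrE ?enorm_tuple_ge0// mulr_ge0//.
    by apply: sumr_ge0 => ? _; exact: enorm_tuple_ge0.
  by rewrite exprMn ler_wpM2l ?sqr_ge0// sqr_sum_le.
apply: le_trans (esumZl _ _) _.
- by rewrite mulr_ge0 ?sqr_ge0.
- by move=> k; apply: sume_ge0.
rewrite esum_sum; last by [].
under eq_bigr do
  rewrite (esum_shift _ (fun k => (dx * enorm_tuple (H k) ^+ 2)%:E)).
rewrite big_const_seq count_predT iter_addr_0.
have -> : ((K * n) ^+ 2)%:E = ((K ^+ 2 * n)%:E * n%:E)%E :> \bar R.
  by rewrite -EFinM; congr EFin; ring.
by rewrite -muleA mule_natl.
Qed.

End TupleNorm.

(** * Linearity and stencil bound of the difference operator *)

Section Delta.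
Context {R : realType} (r s : nat) (alpha : int -> R).

Lemma deltaB (W : lmodType R) (F G : int -> W) k :
  delta r s alpha (fun k => F k - G k) k =
  delta r s alpha F k - delta r s alpha G k.
Proof.
have num_fluxB l : num_flux r s alpha (fun k => F k - G k) l =
    num_flux r s alpha F l - num_flux r s alpha G l.
  by rewrite /num_flux -sumrB; apply: eq_bigr => i _; rewrite scalerBr.
by rewrite /delta !num_fluxB opprD addrACA -opprD.
Qed.

Lemma sum_norm_delta (N m q : nat) :
  exists js : seq int, exists2 K : R, 0 <= K &
  forall (F : int -> {ffun 'I_q -> 'M[R]_(N, m)}) k,
    sum_norm (delta r s alpha F k) <= K * \sum_(j <- js) sum_norm (F (k + j)).
Proof.
pose l (i : 'I_(r + s).+1) : int := i%:Z - r%:Z.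
pose K : R := \sum_i `|alpha (l i)|.
have K0 : 0 <= K by exact: sumr_ge0.
(* The stencil lists the offsets of the flux at k + 1/2, then those of the flux at k - 1/2, shifted
   by -1; repetitions are harmless. *)
exists ([seq l i | i <- index_enum 'I_(r + s).+1]
     ++ [seq -1 + l i | i <- index_enum 'I_(r + s).+1]).
exists K => // F k.
have num_flux_le h : sum_norm (num_flux r s alpha F h) <=
    K * \sum_i sum_norm (F (h + l i)).
  apply: le_trans (sum_norm_sum _ _) _; rewrite mulr_sumr.
  apply: ler_sum => i _; rewrite sum_normZ ler_wpM2r ?sum_norm_ge0//.
  by rewrite /K (bigD1 i)//= lerDl sumr_ge0.
apply: le_trans (sum_normD _ _) _; rewrite sum_normN big_cat mulrDr/= !big_map.
apply: lerD; first exact: num_flux_le.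
under eq_bigr do rewrite addrA.
exact: num_flux_le.
Qed.

End Delta.

(** * Linear action of [Lambda] and the algebra of one correction step *)

Lemma mxact_is_linear (R : realType) (N m : nat) (L : 'M[R]_(N * m)) :
  linear (@mxact R N m L).
Proof.
by move=> a u v; rewrite /mxact linearP/= mulmxDl -scalemxAl linearP.
Qed.

HB.instance Definition _ (R : realType) (N m : nat) (L : 'M[R]_(N * m)) :=
  GRing.isLinear.Build R 'M[R]_(N, m) 'M[R]_(N, m) _ (@mxact R N m L)
    (mxact_is_linear L).

Section Correction.
Context {R : realType} {N m q : nat}.
Local Notation V := 'M[R]_(N, m).
Local Notation Vq := {ffun 'I_q -> V}.

Lemma entrywise_linearB (g : {linear V -> V}) (U W : Vq) :
  entrywise g (U - W) = entrywise g U - entrywise g W.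
Proof. by apply/ffunP => i; rewrite !ffunE linearB. Qed.

(* [x], [y], [g] stand for [A M(P F)], [A F] and [Lambda A delta F]; the data
   [f0], [g0], [w] and [z] of the time level cancel. *)
Lemma correction_eq (f f' fs f0 g gs g0 w x x' xs y y' ys z : Vq) (t mu : R) :
  f' - f0 + t *: g0 - mu *: (x' - y') - mu *: z =
    f - f0 + t *: g0 - mu *: (x - y) - mu *: z
    - (f - f0 + t *: g - mu *: (x - y) + t *: w - mu *: z) ->
  fs - f0 + t *: gs - mu *: (xs - ys) + t *: w - mu *: z = 0 ->
  f' - fs + mu *: (y' - ys) = mu *: (x' - xs) - t *: (g - gs).
Proof.
move=> step sol; apply/ffunP => i; apply/matrixP => a b.
have := congr1 (fun U : Vq => U i a b) step.
have := congr1 (fun U : Vq => U i a b) sol.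
by rewrite !(ffunE, mxE); lra.
Qed.

End Correction.

(** * Macroscopic and full error of one correction at a grid point *)

Section Iteration.
Context {R : realType} {N m q : nat}.
Local Notation V := 'M[R]_(N, m).
Local Notation Vq := {ffun 'I_q -> V}.
Context (c : 'I_q.+1 -> R) (Lambda : 'M[R]_(N * m)).
Context (P : {linear V -> 'rV[R]_m}) (M : 'rV[R]_m -> V).
Context (r s : nat) (alpha : int -> R) (dt dx mu : R) (Fn : int -> V).
Hypothesis hPM : forall u, P (M u) = u.

Let A : 'M[R]_q := quad_mx c.
Let MP (v : V) : V := M (P v).
Let L1 := opL1 c Lambda P M r s alpha dt dx mu Fn.
Let L2 := opL2 c Lambda P M r s alpha dt dx mu Fn.

Context (F F' Fs : int -> Vq) (k : int).
Hypothesis step : L1 F' k = L1 F k - L2 F k.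
Hypothesis sol : L2 Fs k = 0.

Let E' : Vq := F' k - Fs k.
Let D : Vq := entrywise MP (F' k) - entrywise MP (Fs k).
Let W : Vq := mix A (delta r s alpha (fun k => F k - Fs k) k).

(** The relaxation term at the old iterate occurs in both [L1 F] and [L2 F] and cancels, so [F]
    enters only through its transport term. *)
Lemma error_eq :
  E' + mu *: mix A E' = mu *: mix A D - (dt / dx) *: entrywise (mxact Lambda) W.
Proof.
have WB : entrywise (mxact Lambda) W =
    entrywise (mxact Lambda) (mix A (delta r s alpha F k)) -
    entrywise (mxact Lambda) (mix A (delta r s alpha Fs k)).
  by rewrite /W deltaB mixB entrywise_linearB.
rewrite WB (mixB A (F' k)) (mixB A (entrywise MP (F' k))).
move: step sol; rewrite /L1 /L2 /opL1 /opL2 -/A -/MP.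
rewrite (mixB A (entrywise MP (F k)) (F k)).
rewrite (mixB A (entrywise MP (F' k)) (F' k)).
rewrite (mixB A (entrywise MP (Fs k)) (Fs k)).
exact: correction_eq.
Qed.

(* [P] annihilates the stiff relaxation term, since [P (M (P v)) = P v]. *)
Lemma macro_error_eq i : P (E' i) = - ((dt / dx) *: P (mxact Lambda (W i))).
Proof.
(* Mixing acts on the sub-time-step index only, so it commutes with [P]. *)
have PD : P (mix A D i) = P (mix A E' i).
  rewrite ![mix A _ i]ffunE !linear_sum.
  apply: eq_bigr => j _; rewrite !linearZ/=; congr (_ *: _).
  by rewrite /D /E' !ffunE !linearB/= /MP !hPM.
have PE (U1 U2 U3 U4 : Vq) (a b : R) : U1 + a *: U2 = a *: U3 - b *: U4 ->
    P (U1 i) + a *: P (U2 i) = a *: P (U3 i) - b *: P (U4 i).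
  move=> /(congr1 (fun U : Vq => P (U i))).
  by rewrite !ffunE linearD linearB !linearZ.
have := PE _ _ _ _ _ _ error_eq; rewrite PD addrC => /addrI ->.
by rewrite ffunE.
Qed.

(** Solving [error_eq] for [E'] leaves [mu] only in combinations that are bounded uniformly in
    eps. *)
Lemma micro_error_eq : 1%:M + mu *: A \in unitmx ->
  E' = mix (mu *: (invmx (1%:M + mu *: A) *m A)) D -
       (dt / dx) *: mix (invmx (1%:M + mu *: A)) (entrywise (mxact Lambda) W).
Proof.
move=> Bu; set B := 1%:M + mu *: A in Bu *.
have -> : E' = mix (invmx B) (mix B E') by rewrite -mix_mul mulVmx// mix1.
rewrite {1}/B mixDl mix1 mix_scale error_eq.
by rewrite mixB !mixZ mix_scale mix_mul.
Qed.

Lemma sum_norm_error (KM KP KL C C' : R) : 0 <= KM -> 0 <= KP -> 0 <= KL ->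
  0 <= dt / dx ->
  (forall u v, `|M u - M v| <= KM * `|u - v|) ->
  (forall v, `|P v| <= KP * `|v|) ->
  (forall v, `|mxact Lambda v| <= KL * `|v|) ->
  1%:M + mu *: A \in unitmx ->
  (forall i j, `|invmx (1%:M + mu *: A) i j| <= C) ->
  (forall i j, `|(mu *: (invmx (1%:M + mu *: A) *m A)) i j| <= C') ->
  0 <= C -> 0 <= C' ->
  sum_norm E' <= q%:R * (dt / dx) * KL * (C' * KM * KP + C) * sum_norm W.
Proof.
move=> KM0 KP0 KL0 t0 MK PK LK Bu BC BC' C0 C'0; set t := dt / dx in t0 *.
(* The Maxwellians see only the macroscopic error [P E'], which [macro_error_eq] bounds by [W]
   without any factor [mu]. *)
have DW : sum_norm D <= KM * (t * (KP * KL)) * sum_norm W.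
  rewrite mulr_sumr; apply: ler_sum => i _.
  have -> : D i = M (P (F' k i)) - M (P (Fs k i)) by rewrite /D !ffunE.
  apply: le_trans (MK _ _) _; rewrite -mulrA ler_wpM2l//.
  have -> : P (F' k i) - P (Fs k i) = P (E' i) by rewrite /E' !ffunE linearB.
  rewrite macro_error_eq normrN normrZ ger0_norm// -mulrA ler_wpM2l//.
  by apply: le_trans (PK _) _; rewrite -mulrA ler_wpM2l.
rewrite {1}micro_error_eq//; apply: le_trans (sum_normD _ _) _.
rewrite sum_normN sum_normZ ger0_norm//.
have LW := sum_norm_entrywise W LK.
have S1 := sum_norm_mix D BC'.
have S2 := sum_norm_mix (entrywise (mxact Lambda) W) BC.
apply: (@le_trans _ _ (q%:R * C' * (KM * (t * (KP * KL)) * sum_norm W) +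
   t * (q%:R * C * (KL * sum_norm W)))); last first.
  by rewrite le_eqVlt; apply/orP; left; apply/eqP; rewrite /t; ring.
apply: lerD.
  by apply: le_trans S1 _; rewrite ler_wpM2l// mulr_ge0.
rewrite ler_wpM2l//; apply: le_trans S2 _.
by rewrite ler_wpM2l// mulr_ge0.
Qed.

End Iteration.

(** * Contraction uniform in eps, iterated over the corrections *)

Theorem proposition2p3 (R : realType) (m N q : nat)
  (hm : (1 <= m)%N) (hN : (1 <= N)%N) (hq : (1 <= q)%N)
  (Lambda : 'M[R]_(N * m)) (hLambda : is_diag_mx Lambda)
  (P : {linear 'M[R]_(N, m) -> 'rV[R]_m})
  (M : 'rV[R]_m -> 'M[R]_(N, m)) (f : 'rV[R]_m -> 'rV[R]_m)
  (hPM : forall u, P (M u) = u)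
  (hPLM : forall u, P (mxact Lambda (M u)) = f u)
  (c : 'I_q.+1 -> R)
  (hc0 : c ord0 = 0) (hcq : c ord_max = 1)
  (hc : forall i j : 'I_q.+1, (i < j)%N -> c i < c j)
  (Fn : int -> 'M[R]_(N, m))
  (dt dx : R) (hdt : 0 < dt) (hdx : 0 < dx)
  (r s : nat) (alpha : int -> R) (halpha : consistent r s alpha)
  (hM : lipschitz M)
  (hA : exists C C' : R, [/\ 0 < C, 0 < C' &
     forall eps : R, 0 < eps ->
       let mu := dt / eps in
       let B : 'M[R]_q := 1%:M + mu *: quad_mx c in
       [/\ B \in unitmx,
           opnorm (invmx B) <= C &
           mu * opnorm (invmx B *m quad_mx c) <= C']]) :
  exists2 theta : R, 0 < theta &
    forall eps : R, 0 < eps ->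
    let L1 := opL1 c Lambda P M r s alpha dt dx (dt / eps) Fn in
    let L2 := opL2 c Lambda P M r s alpha dt dx (dt / eps) Fn in
    (* X is the class of grid functions in which the solution is unique *)
    forall (X : set (int -> {ffun 'I_q -> 'M[R]_(N, m)}))
      (Fstar : int -> {ffun 'I_q -> 'M[R]_(N, m)})
      (Fp : nat -> int -> {ffun 'I_q -> 'M[R]_(N, m)}),
    unique (fun F => X F /\ forall k, L2 F k = 0) Fstar ->
    Fp 0%N = start Fn ->
    (forall p k, L1 (Fp p.+1) k = L1 (Fp p) k - L2 (Fp p) k) ->
    forall p : nat,
      (l2norm dx (fun k => (Fp p.+1 k - Fstar k)%R)
       <= ((theta * dt) ^+ p.+1)%:E
          * l2norm dx (fun k => (Fp 0%N k - Fstar k)%R))%E.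
Proof.
have [C [C' [/ltW C0 /ltW C'0 hB]]] := hA.
have [KM KM0 MK] := lipschitz_bound hM.
have [KP KP0 PK] := linear_mx_bounded P.
have [KL KL0 LK] := linear_mx_bounded (mxact Lambda).
have [js [Kd Kd0 deltaK]] := @sum_norm_delta R r s alpha N m q.
have t0 : 0 <= dt / dx by rewrite divr_ge0// ltW.
pose a := `|opnorm (quad_mx c)|.
pose K1 := q%:R * (dt / dx) * KL * (C' * KM * KP + C).
have K10 : 0 <= K1.
  apply: mulr_ge0; first by do 2 (apply: mulr_ge0 => //).
  by rewrite addr_ge0// !mulr_ge0.
(* From left to right: return to the Euclidean norm, one-step bound, mixing by [quad_mx c],
   difference operator, passage to [sum_norm]. *)
pose K := N%:R * m%:R * (K1 * (q%:R * a * (Kd * q%:R))).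
have K0 : 0 <= K.
  apply: mulr_ge0; first exact: mulr_ge0.
  apply: mulr_ge0 => //; apply: mulr_ge0; last exact: mulr_ge0.
  by rewrite mulr_ge0 ?normr_ge0.
have n0 : 0 <= K * (size js)%:R by rewrite mulr_ge0.
(* All constants are fixed before [eps] is introduced. The added 1 makes theta positive even when
   [K] vanishes; division by [dt] makes [theta * dt] the contraction factor. *)
exists ((K * (size js)%:R + 1) / dt); first by rewrite divr_gt0// ltr_wpDl.
move=> eps eps0 L1 L2 X Fs Fp [[_ sol] _] F0 step.
have [Bu BC BC'] := hB eps eps0.
have mu0 : 0 < dt / eps by rewrite divr_gt0.
have BCe i j : `|invmx (1%:M + dt / eps *: quad_mx c) i j| <= C.
  exact: le_trans (le_entry_opnorm _ _ _) BC.
have BCe' i j :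
    `|(dt / eps *: (invmx (1%:M + dt / eps *: quad_mx c) *m quad_mx c)) i j|
      <= C'.
  rewrite mxE normrM gtr0_norm//; apply: le_trans BC'.
  by rewrite ler_wpM2l ?(ltW mu0)// le_entry_opnorm.
have AC i j : `|quad_mx c i j| <= a.
  exact: le_trans (le_entry_opnorm _ _ _) (ler_norm _).
rewrite divfK ?gt_eqF//.
have contract p : (l2norm dx (fun k => (Fp p.+1 k - Fs k)%R) <=
    (K * (size js)%:R)%:E * l2norm dx (fun k => (Fp p k - Fs k)%R))%E.
  (* Reduced to a bound at one grid point; the factors of [K] are then peeled off in order. *)
  apply: l2norm_le_stencil => //; first exact: ltW.
  move=> k; apply: le_trans (enorm_tuple_le _) _.
  rewrite -[leRHS]mulrA ler_wpM2l ?mulr_ge0//.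
  apply: le_trans (sum_norm_error hPM (step p k) (sol k) KM0 KP0 KL0 t0 MK PK
    LK Bu BCe BCe' C0 C'0) _.
  rewrite -[leRHS]mulrA ler_wpM2l//.
  apply: le_trans (sum_norm_mix _ AC) _.
  rewrite -[leRHS]mulrA ler_wpM2l ?mulr_ge0 ?normr_ge0//.
  apply: le_trans (deltaK _ _) _.
  rewrite -[leRHS]mulrA ler_wpM2l// mulr_sumr.
  by apply: ler_sum => j _; exact: sum_norm_le_enorm.
have l2_ge0 G : (0 <= @l2norm R N m q dx G)%E by exact: sqrte_ge0.
have contract1 p : (l2norm dx (fun k => (Fp p.+1 k - Fs k)%R) <=
    (K * (size js)%:R + 1)%:E * l2norm dx (fun k => (Fp p k - Fs k)%R))%E.
  apply: le_trans (contract p) _; apply: lee_wpmul2r => //.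
  by rewrite lee_fin lerDl.
elim=> [|p IH]; first by rewrite expr1.
apply: le_trans (contract1 p.+1) _; rewrite exprS EFinM -muleA.
by apply: lee_wpmul2l => //; rewrite lee_fin addr_ge0.
Qed.
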